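(* Let $\mathbb{K}$ be a field, $n,d\ge1$ and $k\ge0$ integers. The Hilbert series of the Veronese module $S_{n,d,k}$ is $$HS(S_{n,d,k};z)=\frac{1}{(n-1)!}\,\frac{d^{\,n-1}}{dz^{\,n-1}}\left[\frac{z^{k+n-1}}{1-z^d}\right].$$
   Context: $S=\mathbb{K}[x_1,\dots,x_n]=\bigoplus_{j\ge0}S_j$ with the standard grading, and $S_{n,d,k}=\bigoplus_{i\ge0}S_{k+id}$, graded as a subspace of $S$ (elements of $S_{k+id}$ have degree $k+id$). $HS(M;z)=\sum_j\dim_{\mathbb{K}}(M_j)z^j$ is the Hilbert series. In the expression $\frac{d^{\,n-1}}{dz^{\,n-1}}$ the symbol denotes the $(n-1)$-st derivative with respect to $z$, while $d$ in $1-z^d$ is the given integer. *)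

(* Defs.v *)
From HB Require Import structures.
From mathcomp Require Import all_boot all_order all_algebra.
From mathcomp.multinomials Require Import mpoly.
From Stdlib Require ClassicalEpsilon.

Set Implicit Arguments.
Unset Strict Implicit.
Unset Printing Implicit Defensive.

Import GRing.Theory.
Local Open Scope ring_scope.

Section PowerSeries.
Variable F : fieldType.

(* The power series \sum_i (f i) z^i is encoded by its coefficient function. *)
Definition fps := nat -> F.

Implicit Types f g : fps.

Definition fps_of_poly (p : {poly F}) : fps := fun i => p`_i.

Definition fps_mul f g : fps := fun i => \sum_(j < i.+1) f j * g (i - j)%N.

Definition fps_scale (a : F) f : fps := fun i => a * f i.

Definition fps_deriv f : fps := fun i => f i.+1 *+ i.+1.

(* The list of the coefficients 0, ..., m of 1 / f, obtained by solving
   f * g = 1 degree by degree; see fps_mulV. *)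
Fixpoint fps_inv_seq f (m : nat) : seq F :=
  if m is m'.+1 then
    let s := fps_inv_seq f m' in
    rcons s (- (f 0%N)^-1 * \sum_(i < m) f (m - i)%N * s`_i)
  else [:: (f 0%N)^-1].

Definition fps_inv f : fps := fun i => (fps_inv_seq f i)`_i.

Definition fps_div f g : fps := fps_mul f (fps_inv g).

Lemma size_fps_inv_seq f m : size (fps_inv_seq f m) = m.+1.
Proof. by elim: m => //= m IH; rewrite size_rcons IH. Qed.

Lemma nth_fps_inv_seq f m i : (i <= m)%N -> (fps_inv_seq f m)`_i = fps_inv f i.
Proof.
elim: m => [|m IH]; first by rewrite leqn0 => /eqP ->.
rewrite leq_eqVlt => /orP[/eqP-> //|lt_im].
by rewrite /= nth_rcons size_fps_inv_seq lt_im IH.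
Qed.

Lemma fps_mulV f : f 0%N != 0 -> fps_mul f (fps_inv f) =1 fps_of_poly 1.
Proof.
move=> f0 [|m]; rewrite /fps_mul /fps_of_poly coef1.
  by rewrite big_ord_recl big_ord0 addr0 /fps_inv /= divff.
rewrite big_ord_recl subn0 {1}/fps_inv /= nth_rcons size_fps_inv_seq ltnn eqxx.
rewrite mulNr mulrN mulVKf // addrC; apply/eqP; rewrite subr_eq0; apply/eqP.
rewrite (reindex_inj rev_ord_inj) /=; apply: eq_bigr => i _.
have le_im : (i <= m)%N by rewrite -ltnS ltn_ord.
have -> : bump 0 (m.+1 - i.+1) = (m.+1 - i)%N by rewrite /bump subSS add1n subSn.
by rewrite subKn ?leqW // nth_fps_inv_seq.
Qed.

End PowerSeries.

Section Dimension.
Variables (K : fieldType) (V : lmodType K).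

(* The subset U of V is a linear subspace with a basis of m elements. *)
Definition has_dim (U : V -> Prop) (m : nat) : Prop :=
  exists b : 'I_m -> V,
    (forall v, U v <-> exists c : 'I_m -> K, v = \sum_i c i *: b i) /\
    (forall c : 'I_m -> K, \sum_i c i *: b i = 0 -> forall i, c i = 0).

(* Meaningful for finite-dimensional subspaces; see dimension_eq. *)
Definition dimension (U : V -> Prop) : nat :=
  ClassicalEpsilon.epsilon (inhabits 0%N) (has_dim U).

Lemma has_dim_leq U m m' : has_dim U m -> has_dim U m' -> (m <= m')%N.
Proof.
case=> b [bU bfree] [b' [b'U _]].
have cP i : exists c : 'rV[K]_m', b i == \sum_j c 0 j *: b' j.
  have /b'U[c ->] : U (b i).
    apply/bU; exists (fun j => (j == i)%:R).
    rewrite (bigD1 i) //= eqxx scale1r big1 ?addr0 // => j /negPf->.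
    by rewrite scale0r.
  by exists (\row_j c j); apply/eqP/eq_bigr => j _; rewrite mxE.
pose A := \matrix_i xchoose (cP i).
have AE i : b i = \sum_j A i j *: b' j.
  rewrite {1}(eqP (xchooseP (cP i))); apply: eq_bigr => j _.
  by rewrite !mxE.
suff /eqP <- : row_free A by exact: rank_leq_col.
rewrite -kermx_eq0; apply/rowV0P => u /sub_kermxP uA0.
apply/rowP => i; rewrite mxE; apply: (bfree (fun i => u 0 i)).
under eq_bigr do rewrite AE scaler_sumr.
rewrite exchange_big /= big1 // => j _.
under eq_bigr do rewrite scalerA.
by rewrite -scaler_suml; move/rowP/(_ j): uA0; rewrite !mxE => ->; rewrite scale0r.
Qed.

Lemma dimension_eq U m : has_dim U m -> dimension U = m.
Proof.
move=> Um; have UE : has_dim U (dimension U).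
  by apply: ClassicalEpsilon.epsilon_spec; exists m.
by apply/eqP; rewrite eqn_leq (has_dim_leq UE Um) (has_dim_leq Um UE).
Qed.

End Dimension.

Section Veronese.
Variables (K : fieldType) (n : nat).

Definition graded_part (M : {mpoly K[n]} -> Prop) (j : nat)
    (p : {mpoly K[n]}) : Prop :=
  M p /\ p \is j.-homog.

Definition hilbert_series (M : {mpoly K[n]} -> Prop) : fps rat :=
  fun j => (dimension (graded_part M j))%:R.

(* The sum of the subspaces S_(k + i * d), i >= 0, of S = K[x_1, ..., x_n];
   it is direct since these are distinct graded parts of S when d > 0. *)
Definition veronese (d k : nat) (p : {mpoly K[n]}) : Prop :=
  exists (N : nat) (q : 'I_N -> {mpoly K[n]}),
    (forall i : 'I_N, q i \is (k + i * d)%N.-homog) /\ p = \sum_(i < N) q i.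

End Veronese.

Arguments veronese K n d k : clear implicits.

(* Main.v *)
Require Import Defs.
From HB Require Import structures.
From mathcomp Require Import all_boot all_order all_algebra.
From mathcomp.multinomials Require Import mpoly.
From Stdlib Require FunctionalExtensionality.

Import GRing.Theory.
Local Open Scope ring_scope.

(* Both sides have the same coefficient at z^j. On the left, the degree j part
   is all of S_j when j = k + i d for some i >= 0, and 0 otherwise. On the
   right, z^(k+n-1) / (1 - z^d) is the sum of the z^(k+n-1+id), and the
   (n-1)-st derivative over (n-1)! turns z^(j+n-1) into 'C(j+n-1, n-1) z^j. *)

Section PowerSeriesTheory.
Variable F : fieldType.
Implicit Types (f g : fps F) (p q : {poly F}).

Lemma fps_mul_polyXn a f i :
  fps_mul (fps_of_poly 'X^a) f i = if (a <= i)%N then f (i - a)%N else 0.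
Proof.
rewrite /fps_mul /fps_of_poly; case: leqP => [le_ai | lt_ia].
  rewrite (bigD1 (Ordinal (le_ai : a < i.+1)%N)) //= coefXn eqxx mul1r.
  rewrite big1 ?addr0 // => j; rewrite -val_eqE /= => /negPf ne_ja.
  by rewrite coefXn ne_ja mul0r.
rewrite big1 // => j _; rewrite coefXn ltn_eqF ?mul0r //.
exact: leq_trans (ltn_ord j) lt_ia.
Qed.

Lemma fps_mul_polyB p q f i :
  fps_mul (fps_of_poly (p - q)) f i =
  fps_mul (fps_of_poly p) f i - fps_mul (fps_of_poly q) f i.
Proof.
rewrite /fps_mul /fps_of_poly -sumrB.
by apply: eq_bigr => j _; rewrite coefB mulrBl.
Qed.

(** The coefficient of [z^i] in [(1 - z^d) g^-1 = 1] ties each coefficient of the inverse to the one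
    [d] places below, so strong induction determines them all. *)
Lemma fps_inv_geometric d : (0 < d)%N ->
  fps_inv (fps_of_poly (1 - 'X^d : {poly F})) =1 fun i => (d %| i)%:R.
Proof.
move=> d_gt0; set g := fps_of_poly _.
have g0 : g 0%N != 0.
  by rewrite /g /fps_of_poly coefB coef1 coefXn (ltn_eqF d_gt0) subr0 oner_eq0.
elim/ltn_ind => i IH; have := fps_mulV g0 i.
(* Writing [1] as ['X^0] makes both terms monomials, whose products are mere shifts of
   coefficients. *)
rewrite {1}/g -(expr0 'X).
rewrite fps_mul_polyB !fps_mul_polyXn subn0 /= /fps_of_poly coef1.
case: leqP => [le_di | lt_id].
  have i_gt0 := leq_trans d_gt0 le_di.
  rewrite (IH (i - d)%N) ?ltn_subrL ?d_gt0 // dvdn_subl // gtn_eqF //.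
  by move/eqP; rewrite subr_eq0 => /eqP.
case: i lt_id {IH} => [|i] lt_id; rewrite subr0 => ->; first by rewrite dvdn0.
by rewrite gtnNdvd.
Qed.

Lemma fps_div_Xn_geometric a d i : (0 < d)%N ->
  fps_div (fps_of_poly 'X^a) (fps_of_poly (1 - 'X^d : {poly F})) i =
  ((a <= i) && (d %| i - a))%N%:R.
Proof.
move=> d_gt0; rewrite /fps_div fps_mul_polyXn fps_inv_geometric //.
by case: leqP.
Qed.

Lemma iter_fps_deriv f m i :
  iter m (@fps_deriv F) f i = f (i + m)%N *+ (i + m) ^_ m.
Proof.
elim: m i => [|m IH] i; first by rewrite addn0 ffactn0 mulr1n.
rewrite iterS /fps_deriv IH addSnnS -mulrnA; congr (_ *+ _).
(* The outermost derivative contributes [i + 1], the smallest factor of [(i + m.+1) ^_ m.+1], which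
   [ffactnSr] splits off. *)
by rewrite ffactnSr mulnC addnS -addSn addnK mulnC.
Qed.

End PowerSeriesTheory.

Section HomogeneousParts.
Variable K : fieldType.

Lemma has_dim_set0 (V : lmodType K) : has_dim (fun v : V => v = 0) 0.
Proof.
exists (fun=> 0); split=> [v | c _ []//].
split=> [-> | [c ->]]; last by rewrite big_ord0.
by exists (fun=> 0); rewrite big_ord0.
Qed.

(** A basis of the vector space type [dhomog] is carried into the polynomials by the inclusion,
    which is linear and injective. *)
Lemma has_dim_dhomog n j :
  has_dim (fun p : {mpoly K[n.+1]} => p \is j.-homog) 'C(j + n, n).
Proof.
have <- : \dim {:dhomog n.+1 K j} = 'C(j + n, n).
  (* The type [dhomog] comes with dimension ['C(j + n, j)]; symmetry of binomials gives the form
     wanted. *)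
  by rewrite dimvf -(bin_sub (leq_addl j n)) addnK.
set b := vbasis {:dhomog n.+1 K j}.
have sumE (c : 'I__ -> K) :
    \sum_i c i *: mpoly_of_dhomog b`_i = mpoly_of_dhomog (\sum_i c i *: b`_i).
  by rewrite linear_sum; apply: eq_bigr => i _; rewrite linearZ.
exists (fun i => mpoly_of_dhomog b`_i); split=> [p | c].
  split=> [hp | [c ->]]; last by rewrite sumE; apply: dhomog_is_dhomog.
  exists (fun i => coord b i (DHomog hp)).
  by rewrite sumE -coord_vbasis ?memvf.
rewrite sumE => c0 i; move: (vbasisP {:dhomog n.+1 K j}) => /basis_free/freeP.
by apply; apply: val_inj.
Qed.

Lemma graded_part_veronese n d k j (p : {mpoly K[n]}) :
  (0 < d)%N ->
  graded_part (veronese K n d k) j p <->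
  (if (k <= j)%N && (d %| j - k)%N then is_true (p \is j.-homog) else p = 0).
Proof.
move=> d_gt0; case: ifPn => [/andP[le_kj /dvdnP[i jE]] | not_j].
  split=> [[] // | hp]; split=> //.
  (* Since [j = k + i * d], the family puts [p] at its last index [i] and zero before it. *)
  exists i.+1, (fun l : 'I_i.+1 => if l == ord_max then p else 0); split=> [l|].
    case: eqP => [-> | _]; last exact: dhomog0.
    by rewrite /= -jE subnKC.
  by rewrite -big_mkcond big_pred1_eq.
split=> [[[N [q [hq ->]]] hp] | ->]; last first.
  split; last exact: dhomog0.
  by exists 0%N, (fun=> 0); rewrite big_ord0; split=> [[]|].
(* The sum equals its own degree [j] component, and projecting to degree [j] kills every summand, as
   no [k + i * d] equals [j]. *)
rewrite -[LHS](pihomog_dE hp) linear_sum big1 // => i _.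
apply: (pihomog_ne0 _ (hq i)); apply: contraNneq not_j => <-.
by rewrite leq_addr addKn dvdn_mull.
Qed.

Lemma has_dim_ext (V : lmodType K) (U W : V -> Prop) m :
  (forall v, U v <-> W v) -> has_dim W m -> has_dim U m.
Proof.
move=> UW [b [bW bfree]]; exists b; split=> // v.
by split=> [/UW/bW | /bW/UW].
Qed.

Lemma hilbert_series_veronese n d k j : (0 < d)%N ->
  hilbert_series (veronese K n.+1 d k) j =
  (if (k <= j) && (d %| j - k) then 'C(j + n, n) else 0)%N%:R.
Proof.
move=> d_gt0; rewrite /hilbert_series; congr (_%:R); apply: dimension_eq.
apply: has_dim_ext (fun p => graded_part_veronese _ _ k j p d_gt0) _.
by case: ifP => _; [apply: has_dim_dhomog | apply: has_dim_set0].
Qed.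

End HomogeneousParts.

Theorem corollary2p2 (K : fieldType) (n d k : nat)
    (hn : (1 <= n)%N) (hd : (1 <= d)%N) :
  hilbert_series (veronese K n d k) =
  fps_scale ((n - 1)`!%:R)^-1
    (iter (n - 1) (@fps_deriv rat)
       (fps_div (fps_of_poly 'X^(k + n - 1)) (fps_of_poly (1 - 'X^d)))).
Proof.
case: n hn => // n _; apply: FunctionalExtensionality.functional_extensionality => j.
rewrite hilbert_series_veronese // subn1 addnS subn1 /= /fps_scale.
(* The shift by [n] due to the derivatives cancels the one in the exponent [k + n]. *)
rewrite iter_fps_deriv fps_div_Xn_geometric // leq_add2r subnDr.
case: ifP => _; last by rewrite mul0rn mulr0.
(* The series has coefficients in [rat], so [n!] is invertible whatever the characteristic of
   [K]. *)
have fact_neq0 : n`!%:R != 0 :> rat by rewrite Num.Theory.pnatr_eq0 -lt0n fact_gt0.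
by rewrite -bin_ffact natrM mulrC mulfK.
Qed.
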